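(* The transition kernel $P(d\pi_{t+1}\mid\pi_t,Q_t,\eta_t)$ of the predictor MDP described in the context has the weak Feller property: for every $g\in C_b(\mathcal{P}(\mathbb{X}))$, the map $$(\pi,Q,\eta)\mapsto\int_{\mathcal{P}(\mathbb{X})}g(\pi')\,P(d\pi'\mid\pi,Q,\eta)$$ belongs to $C_b(\mathcal{P}(\mathbb{X})\times\mathcal{Q}\times\mathcal{H})$.
   Context: $\mathbb{X}$ (states), $\mathbb{U}$ (actions), $\mathbb{M}$ (channel symbols) are finite nonempty sets and $P(x'\mid x,u)$ is a transition kernel on $\mathbb{X}$ given $\mathbb{X}\times\mathbb{U}$. $\mathcal{P}(\mathbb{X})$ is the set of probability measures on $\mathbb{X}$ with the weak convergence topology. $\mathcal{Q}=\{Q:\mathbb{X}\to\mathbb{M}\}$ and $\mathcal{H}=\{\eta:\mathcal{Q}\times\mathbb{M}\to\mathbb{U}\}$ are finite sets with the discrete topology. For $q\in\mathbb{M}$ with $\pi(Q^{-1}(q))>0$ put $$F(\pi,Q,\eta,q)(x')=\frac{1}{\pi(Q^{-1}(q))}\sum_{x\in Q^{-1}(q)}P(x'\mid x,\eta(Q,q))\,\pi(x)$$ (arbitrary element of $\mathcal{P}(\mathbb{X})$ otherwise). The transition kernel of the predictor process $\pi_{t+1}=F(\pi_t,Q_t,\eta_t,q_t)$, where given $(\pi_t,Q_t,\eta_t)$ the symbol $q_t$ equals $q$ with probability $\pi_t(Q_t^{-1}(q))$, is $$P(D\mid\pi,Q,\eta)=\sum_{q\in\mathbb{M}}\pi(Q^{-1}(q))\,\mathbf{1}\{F(\pi,Q,\eta,q)\in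 D\},\qquad D\in\mathcal{B}(\mathcal{P}(\mathbb{X})).$$ $C_b(S)$ denotes the bounded continuous real functions on $S$. *)

(* Defs.v *)
From HB Require Import structures.
From mathcomp Require Import all_boot all_order all_algebra.
From mathcomp Require Import all_classical all_reals all_analysis.

Set Implicit Arguments.
Unset Strict Implicit.
Unset Printing Implicit Defensive.

Import Order.TTheory GRing.Theory Num.Theory.
Import numFieldNormedType.Exports.

Local Open Scope classical_set_scope.
Local Open Scope ring_scope.
Local Open Scope ereal_scope.

(* Finite nonempty sets: the distinguished point only witnesses nonemptiness,
   which the library requires of the carrier of a measurable space. *)
#[short(type="finPointedType")]
HB.structure Definition FinPointed := {T of Finite T & Pointed T}.

(* A copy of discrete_topology, because the pointed topological structure of
   the latter is already taken by a special case in the library (cantor.v). *)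
Definition discrete_space (T : Type) : Type := T.
HB.instance Definition _ (T : choiceType) :=
  DiscreteTopology.copy (discrete_space T) (discrete_topology T).
HB.instance Definition _ (T : pointedType) := Pointed.copy (discrete_space T) T.

Notation borel S := (g_sigma_algebraType (@open S)).

(* The set C_b(S) of bounded continuous real functions on S. *)
Definition Cb (S : topologicalType) (R : realType) : set (S -> R) :=
  [set f | continuous f /\ [bounded f x | x in [set: S]]].
Arguments Cb : clear implicits.

(* Borel probability measures on S with the topology of weak convergence: the
   coarsest one making mu |-> \int f dmu continuous for every f in C_b(S). *)
Definition Prob (S : ptopologicalType) (R : realType) : Type :=
  sup_topology (fun f : {f : S -> R | Cb S R f} =>
    Topological.on (initial_topology (fun mu : probability (borel S) R =>
      Rintegral mu setT (sval f : borel S -> R)))).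
HB.instance Definition _ S R := Topological.on (Prob S R).
HB.instance Definition _ S R := Pointed.on (Prob S R).

Definition probability_of_Prob S R (mu : Prob S R) : probability (borel S) R :=
  mu.
Coercion probability_of_Prob : Prob >-> Probability.type.

Lemma fin_sum_sigma_additive d (T : measurableType d) (R : realType)
    (I : finType) (p : pred I) (c : I -> \bar R)
    (m : I -> {measure set T -> \bar R}) :
  (forall i, 0 <= c i) -> (forall i, c i \is a fin_num) ->
  semi_sigma_additive (fun A => \sum_(i | p i) c i * m i A).
Proof.
move=> c0 cfin F mF tF mUF.
rewrite [X in X @ _ --> _](_ : _ = fun n =>
    \sum_(i | p i) \sum_(0 <= j < n) c i * m i (F j)); last first.
  by apply/funext => n; rewrite exchange_big.
apply: cvg_nnesum => [i _|i _].
  by near=> n; apply: sume_ge0 => j _; exact: mule_ge0.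
rewrite [X in X @ _ --> _](_ : _ = fun n =>
    c i * \sum_(0 <= j < n) m i (F j)); last first.
  by apply/funext => n; rewrite ge0_sume_distrr.
by apply: cvgeZl => //; exact: measure_semi_sigma_additive.
Unshelve. all: by end_near. Qed.

Lemma measurable_discrete (T : pointedType)
  (A : set (borel (discrete_space T))) : measurable A.
Proof. by apply: sub_sigma_algebra; exact: discrete_open. Qed.

Lemma fin_sum_measure (R : realType) (I : finPointedType) (J : finType)
    (m : {measure set (borel (discrete_space I)) -> \bar R}) (f : I -> J) j :
  \sum_(i | f i == j) m [set i] = m (f @^-1` [set j]).
Proof.
have -> : f @^-1` [set j] = \bigcup_(i in f @^-1` [set j]) [set i].
  by rewrite bigcup_imset1 image_id.
rewrite measure_fin_bigcup //; first last.
- by move=> i _; exact: measurable_discrete.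
- by move=> i k _ _ [x [/= -> ->]].
- exact: finite_finset.
rewrite (fsbigE (enum [pred i | f i == j])) ?enum_uniq//.
- rewrite big_enum_cond; apply: eq_bigl => i.
  apply/eqP/andP => [fij|[_ /set_mem//]].
  by split; [rewrite inE fij|exact/mem_set].
- by move=> i; rewrite /= mem_enum inE => /eqP.
- by move=> i /= <-; rewrite mem_enum inE eqxx.
Qed.

Section predictor.
Variables (R : realType) (X U M : finPointedType).
Local Notation dX := (discrete_space X).
Local Notation dU := (discrete_space U).

Definition quantizer := {ffun X -> M}.
Definition receiver := {ffun quantizer * M -> U}.

Variable P : R.-pker (borel dX * borel dU) ~> borel dX.
Variable F0 : Prob dX R -> quantizer -> receiver -> M -> Prob dX R.

(* F(pi, Q, eta, q) as a set function, i.e. with P(A | x, u) in place of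
   P(x' | x, u); F0 is the arbitrary value taken when pi (Q^-1(q)) = 0. *)
Definition predictor_fun (pi : Prob dX R) (Q : quantizer) (eta : receiver)
    (q : M) : set (borel dX) -> \bar R :=
  if 0 < pi (Q @^-1` [set q]) then
    fun A => (fine (pi (Q @^-1` [set q])))^-1%:E *
      \sum_(x | Q x == q) P (x, eta (Q, q)) A * pi [set x]
  else F0 pi Q eta q.

Let predictor_fun0 pi Q eta q : predictor_fun pi Q eta q set0 = 0.
Proof.
rewrite /predictor_fun; case: ifPn => _; last exact: measure0.
by rewrite big1 ?mule0// => x _; rewrite measure0 mul0e.
Qed.

Let predictor_fun_ge0 pi Q eta q A : 0 <= predictor_fun pi Q eta q A.
Proof.
rewrite /predictor_fun; case: ifPn => _; last exact: measure_ge0.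
apply: mule_ge0; first by rewrite lee_fin invr_ge0 fine_ge0.
by apply: sume_ge0 => x _; exact: mule_ge0.
Qed.

Let finP (pi : Prob dX R) (A : set (borel dX)) : pi A \is a fin_num.
Proof. by apply: fin_num_measure; exact: measurable_discrete. Qed.

Let predictor_fun_sigma_additive pi Q eta q :
  semi_sigma_additive (predictor_fun pi Q eta q).
Proof.
rewrite /predictor_fun; case: ifPn => _; last exact: measure_semi_sigma_additive.
set c : R := (fine _)^-1%R.
have c0 : (0 <= c)%R by rewrite invr_ge0 fine_ge0.
rewrite [X in semi_sigma_additive X](_ : _ = fun A =>
    \sum_(x | Q x == q) (c%:E * pi [set x]) * P (x, eta (Q, q)) A).
  apply: fin_sum_sigma_additive => x; first by rewrite mule_ge0.
  by rewrite fin_numM// finP.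
apply/funext => A; rewrite ge0_sume_distrr; last first.
  by move=> x _; rewrite mule_ge0.
by apply: eq_bigr => x _; rewrite muleCA; exact: muleC.
Qed.

HB.instance Definition _ pi Q eta q := isMeasure.Build _ _ _
  (predictor_fun pi Q eta q) (predictor_fun0 pi Q eta q)
  (predictor_fun_ge0 pi Q eta q) (@predictor_fun_sigma_additive pi Q eta q).

Let predictor_funT pi Q eta q : predictor_fun pi Q eta q setT = 1.
Proof.
rewrite /predictor_fun; case: ifPn => [p0|_]; last exact: probability_setT.
under eq_bigr do rewrite prob_kernel mul1e.
rewrite fin_sum_measure -[X in _ * X]fineK ?finP// -EFinM mulVf//.
by rewrite gt_eqF// fine_gt0// p0 ltey_eq finP.
Qed.

HB.instance Definition _ pi Q eta q := Measure_isProbability.Build _ _ _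
  (predictor_fun pi Q eta q) (predictor_funT pi Q eta q).

Definition predictor_update pi Q eta q : Prob dX R :=
  (predictor_fun pi Q eta q : probability (borel dX) R).

(* P(. | pi, Q, eta) *)
Definition predictor_kernel (pi : Prob dX R) (Q : quantizer) (eta : receiver)
    (D : set (borel (Prob dX R))) : \bar R :=
  \sum_(q : M) pi (Q @^-1` [set q]) *
    \d_(predictor_update pi Q eta q : borel (Prob dX R)) D.

Let predictor_kernel0 pi Q eta : predictor_kernel pi Q eta set0 = 0.
Proof. by rewrite /predictor_kernel big1// => q _; rewrite measure0 mule0. Qed.

Let predictor_kernel_ge0 pi Q eta D : 0 <= predictor_kernel pi Q eta D.
Proof. by apply: sume_ge0 => q _; exact: mule_ge0. Qed.

Let predictor_kernel_sigma_additive pi Q eta :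
  semi_sigma_additive (predictor_kernel pi Q eta).
Proof.
apply: fin_sum_sigma_additive => q; first exact: measure_ge0.
exact: finP.
Qed.

HB.instance Definition _ pi Q eta := isMeasure.Build _ _ _
  (predictor_kernel pi Q eta) (predictor_kernel0 pi Q eta)
  (predictor_kernel_ge0 pi Q eta) (@predictor_kernel_sigma_additive pi Q eta).

Let predictor_kernelT pi Q eta : predictor_kernel pi Q eta setT = 1.
Proof.
rewrite /predictor_kernel; under eq_bigr do rewrite diracT mule1.
rewrite -(probability_setT pi).
under eq_bigr do rewrite -fin_sum_measure.
transitivity (\sum_(x : X) pi [set x]).
  by rewrite [RHS](partition_big Q xpredT).
have := @fin_sum_measure R X unit pi (fun=> tt) tt.
rewrite (_ : _ @^-1` _ = setT); last by apply/seteqP; split.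
by move=> <-; apply: eq_bigl => x; rewrite eqxx.
Qed.

HB.instance Definition _ pi Q eta := Measure_isProbability.Build _ _ _
  (predictor_kernel pi Q eta) (predictor_kernelT pi Q eta).

End predictor.

(* Main.v *)
Require Import Defs.
From mathcomp Require Import all_boot all_order all_algebra.
From mathcomp Require Import all_classical all_reals all_analysis measurable_realfun.

Import Order.TTheory GRing.Theory Num.Theory.
Import numFieldNormedType.Exports.
Local Open Scope classical_set_scope.
Local Open Scope ring_scope.

(** The kernel P(. | pi, Q, eta) is carried by the finitely many points
F(pi, Q, eta, q), with weights pi(Q^-1(q)), so the integral of g against it is
the finite sum of the pi(Q^-1(q)) g(F(pi, Q, eta, q)) over q
([Rintegral_predictor_kernel]). The sum is bounded because g is and the weights
lie in [0, 1]. Since quantizers and receivers carry the discrete topology, it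
remains to see that each term is continuous in pi, with Q and eta fixed
([predictor_term_continuous]).

Weak convergence on a finite state space is convergence of the mass of every
set ([fine_Prob_continuous] and [Prob_discrete_cvg]). In particular the weight
of q is continuous in pi. Where it is positive, it stays positive nearby, so F
is given there by Bayes' formula, a quotient of continuous functions of pi
([predictor_update_cvg]), and the term is a product of continuous functions.
Where the weight vanishes, F may jump, its value being arbitrary, but g is
bounded, so the product still tends to its value 0. *)

(** * Measurability, product topology and atomic measures *)

Lemma continuous_borel_measurable (S : ptopologicalType) (R : realType)
    (f : S -> R) :
  continuous f -> measurable_fun [set: borel S] (f : borel S -> R).
Proof.
move=> /continuousP cf.
apply: (measurability _ (RGenOInfty.measurableE R)).
move=> _ [_ [a ->] <-]; rewrite setTI; apply: sub_sigma_algebra.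
by apply: cf; exact: interval_open.
Qed.

(** Around (s, t) it suffices to look at the slice over t, an open set. *)
Lemma discrete_prod_continuous (S Y : topologicalType)
    (T : discreteTopologicalType) (f : S * T -> Y) :
  (forall t, continuous (fun s => f (s, t))) -> continuous f.
Proof.
move=> cf [s t] A /cf fA.
exists ([set s' | A (f (s', t))], [set t]).
  by split => //; exact: discrete_set1.
by move=> [s' _] [/= ? ->].
Qed.

Lemma cvg_sum_real (R : realType) (T : Type) (F : set_system T) (I : finType)
    (p : pred I) (f : I -> T -> R) (l : I -> R) :
  Filter F -> (forall i, p i -> f i t @[t --> F] --> l i) ->
  \sum_(i | p i) f i t @[t --> F] --> \sum_(i | p i) l i.
Proof. by move=> FF; apply: cvg_big; exact: add_continuous. Qed.

(** The integrals of the positive and of the negative part of f are finite sums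
of reals, so their difference is the sum of the differences. *)
Lemma Rintegral_atomic d (T : measurableType d) (R : realType)
    (I : finPointedType) (mu : {measure set T -> \bar R}) (c : I -> R)
    (a : I -> T) (f : T -> R) :
  (forall i, 0 <= c i) ->
  (forall A, measurable A -> mu A = (\sum_i (c i)%:E * \d_(a i) A)%E) ->
  measurable_fun setT f ->
  \int[mu]_x f x = \sum_i c i * f (a i).
Proof.
move=> c0 muE mf.
(* Finite sums of measures are indexed by nat in [msum], so I is enumerated; the
default value [point] of [nth] is never reached below #|I|. *)
pose e k := nth point (enum I) k.
have sum_enum (h : I -> \bar R) :
    (\sum_i h i = \sum_(k < #|I|) h (e k))%E.
  by rewrite -big_enum (big_nth point) -cardE big_mkord.
pose m_ k : {measure set T -> \bar R} :=
  mscale (NngNum (c0 (e k))) (\d_(a (e k))).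
have ge0_int (h : T -> R) : (forall x, 0 <= h x) -> measurable_fun setT h ->
    (\int[mu]_x (h x)%:E)%E = (\sum_i c i * h (a i))%:E.
  move=> h0 mh; rewrite (@eq_measure_integral _ _ _ _ (msum m_ #|I|)).
    have mEh : measurable_fun setT (EFin \o h) by exact/measurable_EFinP.
    have hE0 x : setT x -> (0 <= (h x)%:E)%E by rewrite lee_fin.
    rewrite ge0_integral_measure_sum//.
    rewrite -sumEFin sum_enum; apply: eq_bigr => k _.
    rewrite /m_ ge0_integral_mscale//.
    by rewrite integral_dirac// diracT mul1e [RHS]EFinM.
  by move=> A mA _; rewrite muE// sum_enum.
rewrite /Rintegral integralE funerpos funerneg.
rewrite !ge0_int//; [|exact: measurable_funrneg|exact: measurable_funrpos].
rewrite -EFinB/= -sumrB; apply: eq_bigr => i _.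
by rewrite -mulrBr -[in RHS](funrposBneg f).
Qed.

(** * Weak convergence *)

(** The universal property of the coarsest topology making the integrals of
bounded continuous functions continuous. *)
Lemma Prob_cvgP (S : ptopologicalType) (R : realType) (T : Type)
    (F : set_system T) (u : T -> Prob S R) (mu : Prob S R) : Filter F ->
  u t @[t --> F] --> mu <->
  forall f : S -> R, Cb S R f ->
    Rintegral (u t) setT (f : borel S -> R) @[t --> F] -->
    Rintegral mu setT (f : borel S -> R).
Proof.
move=> FF; rewrite cvg_sup; split=> [cu f Cf|cu [f Cf]].
- pose I (nu : probability (borel S) R) := Rintegral nu setT (f : borel S -> R).
  exact: (cvg_comp _ _ (cu (exist _ f Cf)) (@initial_continuous _ _ I mu)).
- move=> A [_ [[B oB <-] Bmu sBA]]; apply: filterS sBA _.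
  by apply: (cu f Cf); exact: open_nbhs_nbhs.
Qed.

Section finite_state.
Variables (R : realType) (X : finPointedType).
Local Notation dX := (discrete_space X).
Implicit Types (pi : Prob dX R) (A : set (borel dX)).

Lemma Cb_discrete (f : dX -> R) : Cb dX R f.
Proof.
split; first by apply/continuousP => A _; exact: discrete_open.
exists (\sum_(x : X) `|f x|); split; first by rewrite num_real.
move=> C fC x _; apply: le_trans (ltW fC).
by rewrite (bigD1 (x : X))//= lerDl sumr_ge0.
Qed.

Lemma Prob_fin_num pi A : pi A \is a fin_num.
Proof. by apply: fin_num_measure; exact: measurable_discrete. Qed.

Lemma fine_Prob_ge0 pi A : 0 <= fine (pi A).
Proof. exact: fine_ge0. Qed.

Lemma fine_Prob_le1 pi A : fine (pi A) <= 1.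
Proof.
rewrite -lee_fin fineK ?Prob_fin_num//; apply: probability_le1.
exact: measurable_discrete.
Qed.

Lemma Rintegral_discrete pi (f : dX -> R) :
  Rintegral pi setT (f : borel dX -> R) = \sum_(x : X) fine (pi [set x]) * f x.
Proof.
apply: (@Rintegral_atomic _ _ _ _ _ _ (fun x : X => x : borel dX)) => [x|A _|].
- exact: fine_Prob_ge0.
- transitivity (\sum_(x : X | (x : borel dX) \in A) pi [set x])%E.
    have := @fin_sum_measure R X bool pi (fun x => (x : borel dX) \in A) true.
    rewrite (_ : _ @^-1` _ = A); last first.
      by apply/seteqP; split=> x /=; [move/set_mem|move/mem_set].
    by move=> <-; apply: eq_bigl => x; rewrite eqb_id.
  rewrite big_mkcond/=; apply: eq_bigr => x _.
  rewrite fineK ?Prob_fin_num// diracE.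
  by case: ifPn; rewrite ?mule1 ?mule0.
- by apply: continuous_borel_measurable; case: (Cb_discrete f).
Qed.

(** The indicator of any set is bounded and continuous on a discrete space, so
it is a test function for weak convergence. *)
Lemma fine_Prob_continuous A : continuous (fun pi : Prob dX R => fine (pi A)).
Proof.
move=> pi.
have /Prob_cvgP/(_ _ (Cb_discrete (\1_A))) : nu @[nu --> nbhs pi] --> pi by [].
have RE (nu : Prob dX R) : Rintegral nu setT (\1_A : borel dX -> R) = fine (nu A).
  by rewrite /Rintegral integral_indic ?setIT//; exact: measurable_discrete.
by under eq_cvg do rewrite RE; rewrite RE.
Qed.

(** Integrals are finite linear combinations of the masses of the points, so
they converge when the masses do. *)
Lemma Prob_discrete_cvg T (F : set_system T) (u : T -> Prob dX R) pi :
  Filter F ->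
  (forall A, fine (u t A) @[t --> F] --> fine (pi A)) -> u t @[t --> F] --> pi.
Proof.
move=> FF cu; apply/Prob_cvgP => f _; rewrite Rintegral_discrete.
under eq_cvg do rewrite Rintegral_discrete.
apply: cvg_sum_real => x _; apply: cvgMr_tmp; exact: cu.
Qed.

End finite_state.

(** * The predictor process *)

Section predictor_continuity.
Variables (R : realType) (X U M : finPointedType).
Local Notation dX := (discrete_space X).
Local Notation dU := (discrete_space U).
Variable P : R.-pker (borel dX * borel dU) ~> borel dX.
Variable F0 : Prob dX R -> quantizer X M -> receiver X U M -> M -> Prob dX R.
Variables (Q : quantizer X M) (eta : receiver X U M).
Implicit Types (pi : Prob dX R) (q : M) (A : set (borel dX)).

Let weight q pi : R := fine (pi (Q @^-1` [set q])).
Let update q pi : Prob dX R := predictor_update P F0 pi Q eta q.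

Let kernel_fin_num z A : P z A \is a fin_num.
Proof.
rewrite ge0_fin_numE//; apply: (@le_lt_trans _ _ (P z setT)).
  by apply: le_measure; rewrite ?inE//; exact: measurable_discrete.
by rewrite prob_kernel ltry.
Qed.

Lemma predictor_updateE q pi A : 0 < weight q pi ->
  fine (update q pi A) = (weight q pi)^-1 *
    \sum_(x | Q x == q) fine (P (x, eta (Q, q)) A) * fine (pi [set x]).
Proof.
rewrite /update /predictor_update /= => w0.
rewrite /predictor_fun ifT; last first.
  by rewrite -[X in (_ < X)%E]fineK ?Prob_fin_num// lte_fin.
rewrite (eq_bigr (fun x => (fine (P (x, eta (Q, q)) A) * fine (pi [set x]))%:E)).
  by rewrite sumEFin.
by move=> x _; rewrite EFinM !fineK ?Prob_fin_num.
Qed.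

(** The update is continuous at every belief giving q positive probability: the
weight of q is positive on a whole neighbourhood, where Bayes' formula holds. *)
Lemma predictor_update_cvg q pi : 0 < weight q pi ->
  update q nu @[nu --> pi] --> update q pi.
Proof.
move=> w0.
have wc : weight q nu @[nu --> pi] --> weight q pi by exact: fine_Prob_continuous.
apply: (@Prob_discrete_cvg R X _ (nbhs pi)) => A; rewrite predictor_updateE//.
have : {near pi, (fun nu => (weight q nu)^-1 *
    \sum_(x | Q x == q) fine (P (x, eta (Q, q)) A) * fine (nu [set x])) =1
    (fun nu => fine (update q nu A))}.
  near=> nu; rewrite predictor_updateE//; near: nu.
  exact: (cvgr_gt _ wc).
move=> near_eq; apply: cvg_trans (near_eq_cvg near_eq) _.
have wVc : (weight q nu)^-1 @[nu --> pi] --> (weight q pi)^-1.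
  by apply: (cvgV _ wc); rewrite gt_eqF.
apply: (cvgM wVc).
apply: cvg_sum_real => x _; apply: cvgMl_tmp; exact: fine_Prob_continuous.
Unshelve. all: by end_near. Qed.

(** Continuity also holds at beliefs giving q probability 0, where the update is
arbitrary: there the term is dominated by the weight times a bound of g. *)
Lemma predictor_term_continuous (g : Prob dX R -> R) q : Cb (Prob dX R) R g ->
  continuous (fun pi => weight q pi * g (update q pi)).
Proof.
move=> [cg [C [_ gC]]] pi.
have wc : weight q nu @[nu --> pi] --> weight q pi by exact: fine_Prob_continuous.
have [w0|] := ltP 0 (weight q pi).
  have gc :=
    cvg_comp (update q) g (predictor_update_cvg q pi w0) (cg (update q pi)).
  exact: (cvgM wc gc).
rewrite le_eqVlt ltNge fine_Prob_ge0 orbF => /eqP w0.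
have C1 nu : `|g nu| <= C + 1 by apply: gC => //; rewrite ltrDl.
have zc : (fun=> 0 : R) nu @[nu --> nbhs pi] --> (0 : R) by exact: cvg_cst.
have bc : weight q nu * (C + 1) @[nu --> nbhs pi] --> (0 : R).
  by rewrite -[0](mul0r (C + 1)) -w0; exact: cvgMr_tmp.
have nc : `|weight q nu * g (update q nu)| @[nu --> nbhs pi] --> (0 : R).
  apply: (squeeze_cvgr _ zc bc).
  near=> nu; rewrite normr_ge0 normrM ger0_norm ?fine_Prob_ge0//.
  by rewrite ler_wpM2l ?fine_Prob_ge0.
rewrite /continuous_at w0 mul0r; exact: (norm_cvg0 nc).
Unshelve. all: by end_near. Qed.

Lemma Rintegral_predictor_kernel (g : Prob dX R -> R) pi : continuous g ->
  \int[predictor_kernel P F0 pi Q eta]_pi' g pi' =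
  \sum_q weight q pi * g (update q pi).
Proof.
move=> cg; apply: Rintegral_atomic => [q|D _|].
- exact: fine_Prob_ge0.
- by apply: eq_bigr => q _; rewrite fineK ?Prob_fin_num.
- exact: continuous_borel_measurable.
Qed.

End predictor_continuity.

Theorem mainTheorem2 (R : realType) (X U M : finPointedType)
  (P : R.-pker (borel (discrete_space X) * borel (discrete_space U)) ~>
       borel (discrete_space X))
  (F0 : Prob (discrete_space X) R -> quantizer X M -> receiver X U M -> M ->
        Prob (discrete_space X) R)
  (g : Prob (discrete_space X) R -> R) :
  Cb (Prob (discrete_space X) R) R g ->
  Cb (Prob (discrete_space X) R * discrete_space (quantizer X M) *
      discrete_space (receiver X U M))%type R
    (fun s => \int[predictor_kernel P F0 s.1.1 s.1.2 s.2]_pi' g pi').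
Proof.
move=> Cg; have [cg [C [_ gC]]] := Cg; split.
  apply: discrete_prod_continuous => eta.
  apply: discrete_prod_continuous => Q pi /=.
  rewrite /continuous_at Rintegral_predictor_kernel//.
  under eq_cvg do rewrite Rintegral_predictor_kernel//.
  apply: (@cvg_sum_real _ _ (nbhs pi)) => q _.
  exact: predictor_term_continuous.
(* The bound C of g is only known through every real greater than C. *)
exists (\sum_(q : M) (C + 1)); split; first by rewrite num_real.
move=> B CB [[pi Q] eta] _ /=; apply: le_trans (ltW CB).
rewrite Rintegral_predictor_kernel//.
apply: le_trans (ler_norm_sum _ _ _) _; apply: ler_sum => q _.
rewrite normrM ger0_norm ?fine_Prob_ge0// -[leRHS]mul1r.
by rewrite ler_pM ?fine_Prob_ge0 ?fine_Prob_le1//; apply: gC => //; rewrite ltrDl.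
Qed.
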